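(* For every integer $n$ there exists a finite planar graph $G_{n-1}$ which is convertible in a bipartite circle graph and which satisfies $f(G_{n-1})=n$.
   Context: Graphs are finite and simple. For a graph $G$, a set $C$ of vertices is independent if no edge of $G$ joins two vertices of $C$ (the empty set is independent), and $f(G)=\sum_{C}(-1)^{|C|}$, where $C$ runs over all independent sets of vertices of $G$. A bipartite circle graph (BCG) is a finite collection of pairwise disjoint simple closed curves (''circles'') in the plane together with a finite collection of pairwise disjoint embedded arcs (''chords''), with interiors disjoint from the circles, such that the two endpoints of each chord are distinct points lying on the same circle (so each chord lies on one of the two sides of its circle). Its Lando graph has one vertex for each chord, two vertices being joined by an edge if and only if the corresponding chords have their endpoints on the same circle and these endpoints alternate along that circle. A graph is ''convertible in BCG'' (convertible in a bipartite circle graph) if it is isomorphic to the Lando graph of some BCG. *)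

(* Defs.v *)
From HB Require Import structures.
From mathcomp Require Import all_boot all_order all_algebra.
From mathcomp Require Import all_classical all_reals all_analysis.

Set Implicit Arguments.
Unset Strict Implicit.
Unset Printing Implicit Defensive.

Import Order.TTheory GRing.Theory Num.Theory.
Import numFieldNormedType.Exports.

Local Open Scope ring_scope.
Local Open Scope classical_set_scope.

Record sgraph := SGraph {
  vertex :> finType;
  adj : rel vertex;
  adj_sym : symmetric adj;
  adj_irr : irreflexive adj }.

Definition independent (G : sgraph) (C : {set G}) : bool :=
  [forall x in C, forall y in C, ~~ adj x y].

Definition indep_sum (G : sgraph) : int :=
  \sum_(C : {set G} | independent C) (-1) ^+ #|C|.

Definition edges (G : sgraph) : {set {set G}} :=
  finset (fun e : {set G} =>
    [exists u : G, exists v : G, adj u v && (e == [set u; v]%SET)]).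

Notation plane R := (R * R)%type.

(* Curves are maps [R -> plane R] of which only the restriction to [0, 1]
   matters. *)
Definition curve_image (R : realType) (g : R -> plane R) : set (plane R) :=
  g @` `[0, 1].

Definition embedded_arc (R : realType) (g : R -> plane R) : Prop :=
  {within `[0, 1], continuous g} /\ set_inj `[0, 1] g.

Definition arc_ends (R : realType) (g : R -> plane R) : set (plane R) :=
  [set g 0; g 1].

Definition arc_interior (R : realType) (g : R -> plane R) : set (plane R) :=
  g @` `]0, 1[.

Definition simple_closed_curve (R : realType) (g : R -> plane R) : Prop :=
  [/\ {within `[0, 1], continuous g}, g 0 = g 1 &
      set_inj `[0, 1[ g].

Definition planar (R : realType) (G : sgraph) : Prop :=
  exists (p : G -> plane R) (a : {set G} -> R -> plane R),
    [/\ injective p,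
        forall e : {set G}, e \in edges G ->
          embedded_arc (a e) /\ arc_ends (a e) = p @` [set` e],
        forall e : {set G}, e \in edges G ->
          curve_image (a e) `&` range p `<=` p @` [set` e] &
        forall e e' : {set G}, e \in edges G -> e' \in edges G -> e != e' ->
          curve_image (a e) `&` curve_image (a e') `<=` p @` [set` (e :&: e')%SET]].

Record bcg (R : realType) := Bcg {
  circle_idx : finType;
  chord_idx : finType;
  circle : circle_idx -> R -> plane R;
  chord : chord_idx -> R -> plane R;
  circle_closed : forall i, simple_closed_curve (circle i);
  circle_disjoint : forall i j, i != j ->
    curve_image (circle i) `&` curve_image (circle j) = set0;
  chord_arc : forall k, embedded_arc (chord k);
  chord_disjoint : forall k l, k != l ->
    curve_image (chord k) `&` curve_image (chord l) = set0;
  chord_circle_disjoint : forall k i,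
    arc_interior (chord k) `&` curve_image (circle i) = set0;
  chord_on_circle : forall k, exists i,
    arc_ends (chord k) `<=` curve_image (circle i) }.

(* For pairwise distinct a, b, c, d in [0, 1[, the pairs {a, b} and {c, d}
   alternate in the cyclic order of [0, 1] / (0 ~ 1) iff exactly one of c, d
   lies strictly between a and b. *)
Definition interleaved (R : realType) (a b c d : R) : bool :=
  (Num.min a b < c < Num.max a b) (+) (Num.min a b < d < Num.max a b).

Definition lando_adj (R : realType) (B : bcg R) (k l : chord_idx B) : Prop :=
  exists (i : circle_idx B) (a b c d : R),
    [/\ [/\ 0 <= a < 1, 0 <= b < 1, 0 <= c < 1 & 0 <= d < 1],
        circle i a = chord k 0 /\ circle i b = chord k 1,
        circle i c = chord l 0 /\ circle i d = chord l 1 &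
        interleaved a b c d].

Definition convertible_in_bcg (R : realType) (G : sgraph) : Prop :=
  exists (B : bcg R) (h : G -> chord_idx B),
    bijective h /\ forall x y : G, adj x y <-> lando_adj (h x) (h y).

(* Main.v *)
Require Import Defs.
From HB Require Import structures.
From mathcomp Require Import all_boot all_order all_algebra.
From mathcomp Require Import all_classical all_reals all_analysis.
From mathcomp Require Import ring lra zify.

(** Why the theorem holds.  The graphs are strips of [k] consecutive blocks;
    block [q] consists of four vertices [A], [B], [C], [D], with edges
<<
      B_q - D_q - C_q    inside the block,
      A_q, C_q - A_(q+1), B_(q+1)    (all four edges) to the next block.
>>
    Thus a block sees the previous one only through the question whether [A]
    or [C] was chosen there.  Let [x] and [y] be the signed numbers of
    independent sets of the first blocks that do not, respectively do, contain
    the last [A] or the last [C].  If one of them is chosen, then the new [A]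
    and [B] are excluded and the sets on the remaining edge [D - C] contribute
    [0] without [C] and [-1] with [C]; if none is chosen, the new block
    contributes [-1] without [A] and [C], and [1] with one of them.  Hence
    one more block maps [(x, y)] to [(- x, x - y)].  This matrix is a Jordan
    block with eigenvalue [-1], so [x + y] grows linearly, with alternating
    sign ([signed_sum_strip]).  Deleting the very first [A] changes the sign of
    the values ([signed_sum_behead_strip]), and so every integer occurs.

    The strips are Lando graphs because they are defined by crossing
    intervals: the vertices are intervals with distinct integer endpoints, the
    edges are the pairs that overlap without nesting, and two overlapping
    intervals always lie in different classes of a fixed bipartition [side].
    For the circle take a segment of the x-axis closed by a parabola below it,
    and draw the interval [[a, b]] as the arc [y = (x - a) (b - x)] or as its
    mirror image, according to [side] ([diagram_convertible]).

    The strips are planar because they have a book embedding in two pages: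
    the vertices can be placed on the x-axis so that the edges split into two
    classes without crossing inside a class, and the edges are drawn by the
    same parabolas ([book_planar]).  Both drawings rest on the single fact that
    two such arcs meet only in common endpoints unless they lie on the same
    side and their intervals cross ([parab_arc_meet]). *)

Set Implicit Arguments.
Unset Strict Implicit.
Unset Printing Implicit Defensive.

Import Order.TTheory GRing.Theory Num.Theory.
Import numFieldNormedType.Exports.

Local Open Scope ring_scope.
Local Open Scope classical_set_scope.

(** * Parabolic arcs over intervals *)

Definition crossing {d} {T : orderType d} (a b c d' : T) : bool :=
  ((a < c < b) && (b < d') || (c < a < d') && (d' < b))%O.

(** [s] is true for the arcs below the axis. *)
Definition parabola {R : realType} (s : bool) (a b x : R) : R :=
  (-1) ^+ s * ((x - a) * (b - x)).

Definition parab_arc {R : realType} (s : bool) (a b t : R) : plane R :=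
  let x := a + (b - a) * t in (x, parabola s a b x).

Section Geometry.
Variable R : realType.
Implicit Types (a b c d x y t : R) (s : bool).

Lemma continuous_pair (f g : R -> R) :
  continuous f -> continuous g -> continuous (fun t => (f t, g t)).
Proof. by move=> cf cg t; exact: (cvg_pair (cf t) (cg t)). Qed.

Lemma continuous_parab_arc s a b : continuous (parab_arc s a b).
Proof.
have cx : continuous (fun t : R => a + (b - a) * t).
  by move=> t; apply: cvgD; [exact: cvg_cst | apply: cvgMr; exact: cvg_id].
apply: continuous_pair => // t; apply: cvgM; first exact: cvg_cst.
by apply: cvgM; apply: cvgB; (exact: cvg_cst || exact: cx).
Qed.

Lemma parab_arc0 s a b : parab_arc s a b 0 = (a, 0).
Proof. by rewrite /parab_arc /parabola mulr0 addr0 subrr mul0r mulr0. Qed.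

Lemma parab_arc1 s a b : parab_arc s a b 1 = (b, 0).
Proof. by rewrite /parab_arc /parabola mulr1 addrC subrK subrr !mulr0. Qed.

Lemma embedded_parab_arc s a b : a < b -> embedded_arc (parab_arc s a b).
Proof.
move=> ab; split; first exact/continuous_subspaceT/continuous_parab_arc.
move=> t u _ _ [/addrI /mulfI + _]; apply.
by rewrite subr_eq0 gt_eqF.
Qed.

Lemma mem_parab_arc s a b p : a < b -> curve_image (parab_arc s a b) p ->
  a <= p.1 <= b /\ p.2 = parabola s a b p.1.
Proof.
move=> ab [t /=]; rewrite in_itv /= => /andP[t0 t1] <- /=; split=> //.
by apply/andP; split; nra.
Qed.

Lemma mem_parab_arc_interior s a b p : a < b -> arc_interior (parab_arc s a b) p ->
  a < p.1 < b /\ p.2 = parabola s a b p.1.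
Proof.
move=> ab [t /=]; rewrite in_itv /= => /andP[t0 t1] <- /=; split=> //.
by apply/andP; split; nra.
Qed.

Lemma parabola_eq0 s a b x : parabola s a b x = 0 -> x = a \/ x = b.
Proof.
move/eqP; rewrite /parabola mulf_eq0 signr_eq0 /= mulf_eq0 !subr_eq0.
by move=> /orP[] /eqP ->; [left | right].
Qed.

(** Of two parabolas over nested intervals with distinct left endpoints, the
    one over the wider interval is strictly higher, except at a common right
    endpoint. *)
Lemma nested_meet a b c d x : a < c -> c <= x <= d -> d <= b ->
  (x - a) * (b - x) = (x - c) * (d - x) -> d = x.
Proof.
move=> ac /andP[cx xd] db e; apply/le_anti; rewrite xd andbT.
(* The difference of the heights is (c - a) (b - x) + (x - c) (b - d). *)
have h : 0 <= (x - c) * (b - d) by apply: mulr_ge0; lra.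
have : (c - a) * (b - x) <= 0 by nra.
by rewrite pmulr_rle0; lra.
Qed.

(** On opposite sides of the axis the arcs have opposite signs, so they can
    only meet on the axis.  On the same side the intervals are nested or have
    disjoint interiors, and nested parabolas have different heights. *)
Lemma parab_arc_meet s s' a b c d p : a < b -> c < d ->
  (a, b) <> (c, d) -> (s = s' -> ~~ crossing a b c d) ->
  curve_image (parab_arc s a b) p -> curve_image (parab_arc s' c d) p ->
  [/\ p.1 = a \/ p.1 = b, p.1 = c \/ p.1 = d & p.2 = 0].
Proof.
move=> ab cd ne nc /(mem_parab_arc ab)[abx e1] /(mem_parab_arc cd)[cdx e2].
case: p abx cdx e1 e2 => x y /= /andP[ax xb] /andP[cx xd] ->.
(* It suffices that the common height is zero. *)
suff aux : parabola s a b x = parabola s' c d x -> parabola s a b x = 0.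
  move=> e; have e0 := aux e; split=> //; first exact: parabola_eq0 e0.
  by apply: (@parabola_eq0 s'); rewrite -e.
have p1 : 0 <= (x - a) * (b - x) by apply: mulr_ge0; lra.
have p2 : 0 <= (x - c) * (d - x) by apply: mulr_ge0; lra.
rewrite /parabola; have [es|] := eqVneq s s'; last first.
  by case: s s' {nc} => -[] //= _; rewrite ?expr1 ?expr0; nra.
rewrite es => /(mulfI _) e; rewrite e ?signr_eq0 //.
have {e} e : (x - a) * (b - x) = (x - c) * (d - x) by apply: e; rewrite signr_eq0.
suff -> : (x - c) * (d - x) = 0 by rewrite mulr0.
move: (nc es); rewrite /crossing; case: (ltgtP a c) => /= ac.
- rewrite orbF; case: (ltP c b) => cb /=; last by move=> _; nra.
  rewrite -leNgt => db; rewrite (nested_meet ac _ db e) ?cx //.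
  by rewrite subrr mulr0.
- case: (ltP a d) => da /=; last by move=> _; nra.
  rewrite -leNgt => bd; rewrite -e (nested_meet ac _ bd (esym e)) ?ax //.
  by rewrite subrr mulr0.
- move=> _; subst c.
  have : (x - a) * (b - d) = 0 by nra.
  move=> /eqP; rewrite mulf_eq0 => /orP[/eqP ->|]; first by rewrite mul0r.
  by rewrite subr_eq0 => /eqP bd; case: ne; rewrite bd.
Qed.

End Geometry.

Lemma crossing_intr (R : realType) (a b c d : int) :
  crossing (a%:~R : R) b%:~R c%:~R d%:~R = crossing a b c d.
Proof. by rewrite /crossing !(ltr_int R). Qed.

(** * Planarity from a two-page book embedding *)

Section Book.
Variables (R : realType) (G : sgraph) (pos : G -> int) (page : G -> G -> bool).
Hypothesis pos_inj : injective pos.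
Hypothesis page_crossing : forall u v u' v' : G, adj u v -> adj u' v' ->
  crossing (pos u) (pos v) (pos u') (pos v') -> page u v != page u' v'.

Let x (u : G) : R := (pos u)%:~R.

(** [uv] lists the ends of the edge [e] from left to right. *)
Definition oriented_edge (e : {set G}) (uv : G * G) :=
  [&& adj uv.1 uv.2, pos uv.1 < pos uv.2 & e == [set uv.1; uv.2]%SET].

Definition book_arc (e : {set G}) : R -> plane R :=
  if [pick uv | oriented_edge e uv] is Some uv
  then parab_arc (page uv.1 uv.2) (x uv.1) (x uv.2) else fun=> (0, 0).

Lemma book_arcP e : e \in edges G -> exists u v : G,
  [/\ adj u v, x u < x v, e = [set u; v]%SET
    & book_arc e = parab_arc (page u v) (x u) (x v)].
Proof.
rewrite inE => /existsP[u /existsP[v /andP[uv /eqP eE]]].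
rewrite /book_arc; case: pickP => [[u' v'] /and3P[/= h1 h2 /eqP h3]|no].
  by exists u', v'; split=> //; rewrite /x ltr_int.
have [h|h|/pos_inj h] := ltgtP (pos u) (pos v).
- by have := no (u, v); rewrite /oriented_edge /= uv h eE eqxx.
- by have := no (v, u); rewrite /oriented_edge /= adj_sym uv h eE finset.setUC eqxx.
- by rewrite h adj_irr in uv.
Qed.

(** Put the vertices on the x-axis and draw every edge as a parabola over the
    interval between its ends, one page above the axis and the other below. *)
Theorem book_planar : planar R G.
Proof.
have x_inj u v : x u = x v -> u = v by move/intr_inj/pos_inj.
exists (fun u => (x u, 0)), book_arc; split.
- by move=> u v [] /x_inj.
- move=> e /book_arcP[u [v [_ uv -> ->]]]; split; first exact: embedded_parab_arc.
  rewrite /arc_ends parab_arc0 parab_arc1; apply/seteqP; split => p /=.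
    by case=> ->; [exists u | exists v]; rewrite // !inE eqxx ?orbT.
  by case=> w; rewrite !inE => /orP[] /eqP -> <-; [left | right].
- move=> e /book_arcP[u [v [_ uv -> ->]]] p [/(mem_parab_arc uv)[_ p2] [w _ wp]].
  exists w => //=; rewrite !inE.
  move: p2; rewrite -wp => /esym/parabola_eq0 [] /= /x_inj ->; by rewrite eqxx ?orbT.
- move=> e e' /book_arcP[u [v [uv ltuv eE ->]]].
  move=> /book_arcP[u' [v' [uv' ltuv' eE' ->]]] ne p [pe pe'].
  have [] := parab_arc_meet ltuv ltuv' _ _ pe pe'.
  + by case=> /x_inj h1 /x_inj h2; move: ne; rewrite eE eE' h1 h2 eqxx.
  + move=> pg; apply/negP; rewrite crossing_intr.
    by move/(page_crossing uv uv'); rewrite pg eqxx.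
  case: p {pe pe'} => p1 p2 /= h1 h2 ->.
  have [w we wp] : exists2 w, w \in e & p1 = x w.
    by case: h1 => ->; [exists u | exists v]; rewrite // eE !inE eqxx ?orbT.
  have [w' we' wp'] : exists2 w, w \in e' & p1 = x w.
    by case: h2 => ->; [exists u' | exists v']; rewrite // eE' !inE eqxx ?orbT.
  have ww : w = w' by apply: x_inj; rewrite -wp -wp'.
  by exists w; rewrite /= ?wp // inE we ww.
Qed.

End Book.

(** * A circle carrying the chords *)

Section Circle.
Variable R : realType.
Implicit Types (a b m t u : R) (s : bool).

Definition fold01 t : R := 1 - `|1 - 2 * t|.

(** The circle: [fold01] runs from 0 to 1 and back, so that the first factor
    traverses [[0, m]] forth and back; the maximum keeps the curve on the axis
    on the way forth and on the lower parabola on the way back. *)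
Definition bowl m t : plane R :=
  (m * fold01 t, - (m ^+ 2 * (fold01 t * Num.max 0 (2 * t - 1)))).

Lemma continuous_bowl m : continuous (bowl m).
Proof.
have c2 : continuous (fun t : R => 2 * t).
  by move=> t; apply: cvgMr; exact: cvg_id.
have cf : continuous fold01.
  move=> t; apply: cvgB; first exact: cvg_cst.
  by apply: cvg_norm; apply: cvgB; [exact: cvg_cst | exact: c2].
have c21 : continuous (fun t : R => 2 * t - 1).
  by move=> t; apply: cvgB; [exact: c2 | exact: cvg_cst].
apply: continuous_pair => t; first by apply: cvgMr; exact: cf.
apply: cvgN; apply: cvgMr; apply: cvgM; first exact: cf.
have cm : continuous ((fun=> 0 : R) \max (fun t : R => 2 * t - 1)).
  by move=> u; apply: (@continuous_max R R); [exact: cvg_cst | exact: c21].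
exact: cm.
Qed.

Lemma bowl_flat m t : 2 * t <= 1 -> bowl m t = (m * (2 * t), 0).
Proof.
move=> h; rewrite /bowl /fold01 ger0_norm; last by lra.
by rewrite (max_idPl _); last lra; congr (_, _); lra.
Qed.

Lemma bowl_low m t : 1 <= 2 * t ->
  bowl m t = (m * (2 - 2 * t), parabola true 0 m (m * (2 - 2 * t))).
Proof.
move=> h; rewrite /bowl /fold01 /parabola expr1 ler0_norm; last by lra.
by rewrite (max_idPr _); last lra; congr (_, _); ring.
Qed.

Lemma simple_closed_bowl m : 0 < m -> simple_closed_curve (bowl m).
Proof.
move=> m0; split; first exact/continuous_subspaceT/continuous_bowl.
  rewrite bowl_flat; last lra; rewrite bowl_low; last lra.
  by rewrite /parabola; congr (_, _); ring.
have mixed t u : 0 <= t -> u < 1 -> 2 * t <= 1 -> 1 < 2 * u ->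
    bowl m t <> bowl m u.
  move=> t0 u1 ht hu; rewrite bowl_flat // bowl_low ?ltW // => -[_ /esym].
  move/parabola_eq0 => [] /eqP.
    by rewrite mulf_eq0 => /orP[]/eqP; lra.
  by rewrite -subr_eq0 -[X in _ - X]mulr1 -mulrBr mulf_eq0 => /orP[]/eqP; lra.
move=> t u; rewrite !inE /= !in_itv /= => /andP[t0 t1] /andP[u0 u1].
have [ht|ht] := leP (2 * t) 1; have [hu|hu] := leP (2 * u) 1.
- rewrite !bowl_flat // => -[/mulfI]; rewrite gt_eqF // => /(_ isT); lra.
- by move/mixed; case.
- by move/esym/mixed; case.
- rewrite !bowl_low ?ltW // => -[/mulfI]; rewrite gt_eqF // => /(_ isT); lra.
Qed.

Lemma mem_bowl m p : 0 < m -> curve_image (bowl m) p ->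
  [/\ 0 <= p.1, p.1 <= m & p.2 = 0 \/ p.2 = parabola true 0 m p.1].
Proof.
move=> m0 [t /=]; rewrite in_itv /= => /andP[t0 t1] <-.
have [ht|/ltW ht] := leP (2 * t) 1.
  by rewrite bowl_flat //=; split; [nra | nra | left].
by rewrite bowl_low //=; split; [nra | nra | right].
Qed.

(** A chord end lies on the flat part of the circle, where the parameter is an
    increasing function of the abscissa: this is why alternation along the
    circle is crossing of intervals. *)
Lemma bowl_param m a t : 0 < a < m -> 0 <= t < 1 ->
  bowl m t = (a, 0) <-> t = a / (2 * m).
Proof.
move=> /andP[a0 am] /andP[t0 t1]; have m0 : 0 < m by lra.
split=> [|->].
  have [ht|/ltW ht] := leP (2 * t) 1.
    by rewrite bowl_flat // => -[<-]; field; lra.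
  rewrite bowl_low // => -[ea]; rewrite ea => /parabola_eq0[]; lra.
rewrite bowl_flat; first by congr (_, _); field; lra.
by rewrite mulrA -mulf_div mulfV ?mul1r ?ler_pdivrMr //; lra.
Qed.

Lemma param01 m a : 0 < a < m -> 0 <= a / (2 * m) < 1.
Proof.
move=> /andP[a0 am]; rewrite ler_pdivlMr ?ltr_pdivrMr; lra.
Qed.

(** The arcs avoid the axis inside their intervals, and the parabola over
    [[0, m]] is lower than all others. *)
Lemma arc_bowl_disjoint s m a b : 0 < a -> a < b -> b < m ->
  arc_interior (parab_arc s a b) `&` curve_image (bowl m) = set0.
Proof.
move=> a0 ab bm; apply/seteqP; split => // -[x y].
move=> [/(mem_parab_arc_interior ab)[/= /andP[ax xb] ye] /mem_bowl[|/= x0 xm]].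
  by lra.
have p1 : 0 < (x - a) * (b - x) by apply: mulr_gt0; lra.
have lt : (x - a) * (b - x) < (x - 0) * (m - x) by nra.
by rewrite ye /parabola; case: s {ye}; rewrite ?expr0 ?expr1; case; lra.
Qed.

End Circle.

Lemma interleaved_scale (R : realType) (k a b c d : R) :
  0 < k -> a < b -> c < d ->
  a != c -> a != d -> b != c -> b != d ->
  interleaved (a / k) (b / k) (c / k) (d / k) = crossing a b c d.
Proof.
move=> k0 ab cd ac ad bc bd; rewrite /interleaved /crossing.
have kV : 0 < k^-1 by rewrite invr_gt0.
rewrite (min_idPl _) ?ler_pM2r ?(ltW ab) // (max_idPr _) ?ler_pM2r ?(ltW ab) //.
rewrite !ltr_pM2r //.
case: (ltgtP a c) ac => // ac _; case: (ltgtP a d) ad => // ad _;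
case: (ltgtP b c) bc => // bc _; case: (ltgtP b d) bd => //= bd _ //; lra.
Qed.

(** * Lando graphs from interval diagrams *)

Section ChordDiagram.
Variables (R : realType) (G : sgraph) (l r : G -> int) (side : G -> bool).
Hypothesis l_gt0 : forall v, 0 < l v.
Hypothesis l_lt_r : forall v, l v < r v.
Hypothesis ends_distinct : forall u v, u != v ->
  [/\ l u != l v, l u != r v & r u != r v].
Hypothesis adj_crossing : forall u v : G,
  adj u v = crossing (l u) (r u) (l v) (r v).
Hypothesis adj_side : forall u v : G, adj u v -> side u != side v.

(** One circle suffices: the intervals are the chords, those with [side] true
    inside the circle (below the axis) and the others outside. *)
Theorem diagram_convertible : convertible_in_bcg R G.
Proof.
pose lR v : R := (l v)%:~R; pose rR v : R := (r v)%:~R.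
pose chord (v : G) : R -> plane R := parab_arc (side v) (lR v) (rR v).
(* Any number beyond all right endpoints would do. *)
pose M : R := 1 + \sum_v rR v.
have lr v : lR v < rR v by rewrite ltr_int.
have l0 v : 0 < lR v by rewrite ltr0z.
have r0 v : 0 < rR v by apply: lt_trans (l0 v) (lr v).
have rM v : rR v < M.
  rewrite /M (bigD1 v) //= ltr_pwDl //.
  by rewrite lerDl sumr_ge0 // => u _; exact: ltW.
have inM v : 0 < lR v < M /\ 0 < rR v < M.
  by have := l0 v; have := lr v; have := rM v; split; apply/andP; split; lra.
have M0 : 0 < M by rewrite /M ltr_pwDl ?ltr01 // sumr_ge0 // => u _; exact: ltW.
have ends_R u v : u != v ->
    [/\ lR u != lR v, lR u != rR v & rR u != rR v].
  by move/ends_distinct; rewrite /lR /rR !eqr_int.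
have crossE u v : crossing (lR u) (rR u) (lR v) (rR v) = adj u v.
  by rewrite crossing_intr adj_crossing.
have disj u v : u != v -> curve_image (chord u) `&` curve_image (chord v) = set0.
  move=> uv; apply/seteqP; split=> // p [pu pv].
  have [e1 e2 e3] := ends_R _ _ uv.
  have := ends_R v u; rewrite eq_sym => /(_ uv)[_ e4 _].
  have [] := parab_arc_meet (lr u) (lr v) _ _ pu pv.
  - by case=> e; rewrite e eqxx in e1.
  - by move=> sd; rewrite crossE; apply/negP => /adj_side; rewrite sd eqxx.
  - by move=> [] -> [] e _; move: e1 e2 e3 e4; rewrite e eqxx.
have onC v : arc_ends (chord v) `<=` curve_image (bowl M).
  have on a : 0 < a < M -> curve_image (bowl M) (a, 0).
    move=> aM; have p01 := param01 aM; exists (a / (2 * M)).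
      by rewrite /= in_itv /=; case/andP: p01 => -> /ltW ->.
    exact/(bowl_param aM p01).
  have [lM rM'] := inM v.
  by move=> p; rewrite /arc_ends /chord parab_arc0 parab_arc1 => -[] ->; apply: on.
pose B := @Bcg R unit G (fun=> bowl M) chord
  (fun=> simple_closed_bowl M0) (fun i j => ltac:(by case: i; case: j))
  (fun v => embedded_parab_arc (side v) (lr v)) disj
  (fun v _ => arc_bowl_disjoint (side v) (l0 v) (lr v) (rM v))
  (fun v => ex_intro _ tt (onC v)).
exists B, id; split; first by exists id.
move=> u v; rewrite /lando_adj /= /chord !parab_arc0 !parab_arc1.
have [lu ru] := inM u; have [lv rv] := inM v.
have M2 : 0 < 2 * M by lra.
have inter : u != v -> interleaved (lR u / (2 * M)) (rR u / (2 * M))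
    (lR v / (2 * M)) (rR v / (2 * M)) = adj u v.
  move=> uv; have [e1 e2 e3] := ends_R _ _ uv.
  have := ends_R v u; rewrite eq_sym => /(_ uv)[_ e4 _].
  by rewrite interleaved_scale // eq_sym.
split=> [uv|[_ [a [b [c [d [[a01 b01 c01 d01] []]]]]]]].
  exists tt; exists (lR u / (2 * M)), (rR u / (2 * M)),
    (lR v / (2 * M)), (rR v / (2 * M)).
  split; [by split; apply: param01 | | |].
  - by split; apply/bowl_param => //; exact: param01.
  - by split; apply/bowl_param => //; exact: param01.
  - by rewrite inter //; apply: contraL uv => /eqP ->; rewrite adj_irr.
move=> /(bowl_param lu a01) -> /(bowl_param ru b01) -> [].
move=> /(bowl_param lv c01) -> /(bowl_param rv d01) ->.
have [->|uv] := eqVneq u v; last by rewrite inter.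
have lt : lR v / (2 * M) < rR v / (2 * M) by rewrite ltr_pM2r ?invr_gt0.
rewrite /interleaved (min_idPl _) ?(ltW lt) // (max_idPr _) ?(ltW lt) //.
by rewrite !ltxx andbF.
Qed.

End ChordDiagram.

(** * Signed sums by successive choice of vertices *)

Section Recursion.
Variables (T : choiceType) (e : rel T).

(** [X] holds the vertices chosen so far: this is the sum of [(-1) ^ |C|] over
    the independent subsets [C] of [s] without neighbours in [X], evaluated by
    leaving out or choosing the vertices of [s] one by one. *)
Fixpoint signed_sum (s X : seq T) : int :=
  if s is v :: s' then
    signed_sum s' X - (if has (e v) X then 0 else signed_sum s' (v :: X))
  else 1.

End Recursion.

Lemma signed_sum_map (T U : choiceType) (f : U -> T) (e : rel T) s X :
  signed_sum e (map f s) (map f X) = signed_sum (relpre f e) s X.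
Proof.
elim: s X => //= v s IH X; rewrite has_map IH.
by rewrite -[f v :: _]/(map f (v :: X)) IH.
Qed.

Section SignedSum.
Variable G : sgraph.
Implicit Types (s X : seq G) (C : {set G}).

Definition extends s X C :=
  [&& independent C, C \subset s & [forall x in C, ~~ has (adj x) X]].

Lemma extendsP s X C : reflect
  [/\ {in C &, forall x y, ~~ adj x y}, {in C, forall x, x \in s} &
      {in C, forall x, {in X, forall y, ~~ adj x y}}] (extends s X C).
Proof.
apply: (iffP idP) => [/and3P[iC sC fC]|[iC sC fC]]; [split|apply/and3P; split].
- by move=> x y xC yC; move/forall_inP/(_ x xC)/forall_inP/(_ y yC): iC.
- by move=> x xC; exact: (fintype.subsetP sC).
- by move=> x xC; move/forall_inP/(_ x xC): fC => /hasPn.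
- by apply/forall_inP => x xC; apply/forall_inP => y yC; exact: iC.
- exact/fintype.subsetP.
- by apply/forall_inP => x xC; apply/hasPn => y yX; exact: fC.
Qed.

(** Sort the sets by whether they contain the head [v] of the list; those which
    do are [v |: C] with [C] a set for the tail and [v] among the chosen. *)
Lemma signed_sumE s X : uniq s ->
  signed_sum (@adj G) s X = \sum_(C : {set G} | extends s X C) (-1) ^+ #|C|.
Proof.
elim: s X => [|v s IH] X /=.
  move=> _; rewrite (big_pred1 finset.set0) ?cards0 // => C.
  apply/extendsP/eqP => [[_ sC _]|->]; last by split=> x; rewrite inE.
  by apply/setP => x; rewrite inE; apply/negP => /sC.
case/andP=> vs us; rewrite (bigID (fun C : {set G} => v \in C)) /= addrC.
congr (_ + _).
  rewrite IH //; apply: eq_bigl => C; apply/extendsP/andP.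
    case=> iC sC fC; split; last by apply: contra vs => /sC.
    by apply/extendsP; split=> // x /sC xs; rewrite inE xs orbT.
  case=> /extendsP[iC sC fC] vC; split=> // x xC.
  by have := sC x xC; rewrite inE => /orP[/eqP xv|//]; rewrite xv (negPf vC) in xC.
have -> : (if has (adj v) X then 0 else signed_sum (@adj G) s (v :: X)) =
    \sum_(C | ~~ has (adj v) X && extends s (v :: X) C) (-1) ^+ #|C| :> int.
  by case: has => /=; [rewrite big_pred0 | rewrite IH].
rewrite -sumrN; symmetry.
rewrite (reindex_onto (fun C => v |: C)%SET (fun C => C :\ v)%SET) /=; last first.
  by move=> C /andP[_ vC]; rewrite finset.setD1K.
apply: eq_big => [C|C /andP[/andP[_ _] /eqP vC]]; last first.
  have {}vC : v \notin C by rewrite -vC !inE eqxx.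
  by rewrite cardsU1 vC exprS mulN1r.
have -> : ((v |: C)%SET :\ v == C)%SET = (v \notin C).
  apply/eqP/idP => [<-|]; first by rewrite !inE eqxx.
  exact: finset.setU1K.
rewrite finset.setU11 andbT; apply/andP/andP.
  case=> /extendsP[iC sC fC] vC.
  have vX : v \in (v |: C)%SET := finset.setU11 v C.
  split; first by apply/hasPn => y; exact: fC.
  apply/extendsP; split=> [x y xC yC|x xC|x xC y].
  - by apply: iC; rewrite inE ?xC ?yC orbT.
  - have : x \in (v |: C)%SET by rewrite inE xC orbT.
    by move/sC; rewrite inE => /orP[/eqP xv|//]; rewrite -xv xC in vC.
  - have xvC : x \in (v |: C)%SET by rewrite inE xC orbT.
    by rewrite inE => /orP[/eqP ->|]; [exact: iC | exact: fC].
case=> /hasPn vX /extendsP[iC sC fC].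
have vC : v \notin C by apply: contra vs => /sC.
split=> //; apply/extendsP; split=> [x y|x|x].
- rewrite !inE => /orP[/eqP ->|xC] /orP[/eqP ->|yC].
  + by rewrite adj_irr.
  + by rewrite adj_sym; apply: fC; rewrite ?mem_head.
  + by apply: fC; rewrite ?mem_head.
  + exact: iC.
- by rewrite !inE => /orP[->//|/sC ->]; rewrite orbT.
- rewrite !inE => /orP[/eqP ->|xC] y yX; first exact: vX.
  by apply: fC; rewrite // inE yX orbT.
Qed.

Lemma indep_sum_enum s : uniq s -> (forall x, x \in s) ->
  indep_sum G = signed_sum (@adj G) s [::].
Proof.
move=> us fs; rewrite signed_sumE //; apply: eq_bigl => C.
apply/idP/extendsP => [iC|[iC _ _]].
  split=> // x y xC yC; by move/forall_inP/(_ x xC)/forall_inP/(_ y yC): iC.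
by apply/forall_inP => x xC; apply/forall_inP => y yC; exact: iC.
Qed.

End SignedSum.

Section Induced.
Variables (T : choiceType) (e : rel T).
Hypotheses (e_sym : symmetric e) (e_irr : irreflexive e).

Definition induced_sgraph (s : seq T) : sgraph :=
  @SGraph (seq_sub s) (relpre val e) (fun u v => e_sym (val u) (val v))
    (fun u => e_irr (val u)).

Lemma indep_sum_induced s : uniq s ->
  indep_sum (induced_sgraph s) = signed_sum e s [::].
Proof.
move=> us; rewrite (@indep_sum_enum _ (seq_sub_enum s : seq (induced_sgraph s))).
- by rewrite -(signed_sum_map val e (seq_sub_enum s) [::]) val_seq_sub_enum.
- exact: undup_uniq.
- exact: mem_seq_sub_enum.
Qed.

End Induced.

(** * The strips *)

Inductive kind := A | B | C | D.

Definition kind_code k : bool * bool :=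
  match k with A => (false, false) | B => (false, true)
             | C => (true, false) | D => (true, true) end.

Definition code_kind p :=
  match p with (false, false) => A | (false, true) => B
             | (true, false) => C | (true, true) => D end.

Lemma kind_codeK : cancel kind_code code_kind. Proof. by case. Qed.

HB.instance Definition _ := Equality.copy kind (can_type kind_codeK).
HB.instance Definition _ := Choice.copy kind (can_type kind_codeK).

Definition vert := (nat * kind)%type.

(** Consecutive blocks are shifted by 8.  In block 0 only [A] and [C] reach
    into the range of block 1, as far as 12 and 11; there they cross the
    intervals [A] and [B], which begin at 9 and 10 and end later, but not [D],
    which begins at 13. *)
Definition lend (v : vert) : int :=
  8 * v.1%:Z + match v.2 with A => 1 | B => 2 | C => 7 | D => 5 end.
Definition rend (v : vert) : int :=
  8 * v.1%:Z + match v.2 with A => 12 | B => 6 | C => 11 | D => 8 end.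
Definition cross (u v : vert) : bool :=
  crossing (lend u) (rend u) (lend v) (rend v).

Lemma cross_sym : symmetric cross.
Proof. by move=> u v; rewrite /cross /crossing orbC. Qed.

Lemma cross_irr : irreflexive cross.
Proof. by move=> u; rewrite /cross /crossing !ltxx. Qed.

(** The edges, directed towards [D] within a block and forward between
    blocks. *)
Definition arrow (u v : vert) : bool :=
  match u.2, v.2 with
  | A, A | A, B | C, A | C, B => v.1 == u.1.+1
  | B, D | C, D => v.1 == u.1
  | _, _ => false
  end.

Lemma crossE u v : cross u v = arrow u v || arrow v u.
Proof.
case: u v => [q []] [p []]; rewrite /cross /crossing /lend /rend /arrow /=; lia.
Qed.

(** [A], [B] and [C] share a side that alternates from block to block, because
    the only edges between them join consecutive blocks. *)
Definition side (v : vert) : bool := odd v.1 (+) (v.2 == D).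

Lemma cross_side u v : cross u v -> side u != side v.
Proof.
rewrite crossE; case: u v => [q []] [p []]; rewrite /arrow /side /= ?orbF //.
all: by move=> /orP[]/eqP-> /= || move=> /eqP -> /=; case: odd.
Qed.

(** From left to right: ... [C_1], [C_0], [B_0], [D_0], [A_0], [B_1], [D_1],
    [A_1] ...  In the cycle [A_q A_(q+1) C_q B_(q+1)] the corners [A_q] and
    [C_q], which are joined through the earlier blocks, are opposite, and so are
    [A_(q+1)] and [B_(q+1)], which are joined through the later ones.  Hence the
    cycle separates the earlier blocks from the later ones, and a drawing has to
    nest these cycles; this is why the vertices grow to the left as well. *)
Definition pos (v : vert) : int :=
  match v.2 with
  | A => 3 * v.1%:Z + 2 | B => 3 * v.1%:Z | D => 3 * v.1%:Z + 1
  | C => - v.1%:Z - 1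
  end.

Lemma pos_inj : injective pos.
Proof.
case=> [q []] [p []]; rewrite /pos /= => h; try (exfalso; lia);
by congr (_, _); lia.
Qed.

(** For [0 < q] the vertices [B_q] and [D_q] lie under the edge from [A_(q-1)] to
    [A_q], so the edges from the vertices [C] to them need the second page. *)
Definition page (u v : vert) : bool :=
  ((u.2 == C) || (v.2 == C)) && (u.2 != A) && (v.2 != A).

Lemma page_crossing u v u' v' : cross u v -> cross u' v' ->
  crossing (pos u) (pos v) (pos u') (pos v') -> page u v != page u' v'.
Proof.
rewrite !crossE.
case: u v u' v' => [q []] [p []] [q' []] [p' []] //;
rewrite /arrow /crossing /pos /page /= ?orbF; lia.
Qed.

Definition block (q : nat) : seq vert := [:: (q, A); (q, B); (q, C); (q, D)].

Fixpoint strip (q k : nat) : seq vert :=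
  if k is k'.+1 then block q ++ strip q.+1 k' else [::].

(** The vertices [v] that exclude [A] and [B] from block [q]. *)
Definition blocks (q : nat) (v : vert) : bool :=
  match v.2 with A | C => v.1.+1 == q | _ => false end.

Definition below (q : nat) (X : seq vert) : bool := all (fun v => v.1 < q)%N X.

(** The vertices chosen before block [q] act on it only through whether one of
    them satisfies [blocks q], and by [has_blocks_below] they no longer act on
    the blocks after it. *)
Lemma cross_below q k X : below q X ->
  has (cross (q, k)) X = ((k == A) || (k == B)) && has (blocks q) X.
Proof.
elim: X => [|v X IH] /=; first by rewrite andbF.
move=> /andP[vq /IH ->]; rewrite andb_orr; congr (_ || _).
rewrite crossE; case: v k vq {IH} => [p []] [] /= vq; rewrite /arrow /blocks /=; lia.
Qed.

Lemma has_blocks_below q X : below q X -> has (blocks q.+1) X = false.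
Proof.
move=> bX; apply/hasPn => v /(allP bX); rewrite /blocks eqSS.
by case: v.2; case: ltngtP.
Qed.

Lemma belowS q X : below q X -> below q.+1 X.
Proof. by apply: sub_all => v /ltnW. Qed.

Lemma cross_same q k k' : cross (q, k) (q, k') =
  (k == D) && ((k' == B) || (k' == C)) || (k' == D) && ((k == B) || (k == C)).
Proof.
by rewrite crossE; case: k k' => [] []; rewrite /arrow /= ?eqxx //; lia.
Qed.

Lemma strip_next q X : below q X -> (below q.+1 X) * (has (blocks q.+1) X = false).
Proof. by move=> bX; rewrite belowS ?has_blocks_below. Qed.

(** The powers of the Jordan block: a chosen vertex that blocks the first block
    leads to the eigenvalue, any other choice to the linear term. *)
Lemma signed_sum_strip q k X : below q X ->
  signed_sum cross (strip q k) X =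
    (-1) ^+ k * (if has (blocks q) X then 1 else 1 - k%:Z).
Proof.
elim: k q X => [|k IH] q X bX; first by rewrite /= expr0 subr0 if_same.
have bX' := strip_next bX.
rewrite [strip _ _]/= /signed_sum -/(signed_sum cross) /=.
rewrite !cross_below // !cross_same /=.
rewrite !IH /= ?ltnSn ?bX' // /blocks /= ?eqxx /=.
by case: has; rewrite !exprS; ring.
Qed.

(** Without [A] the first block yields the pair [(-1, 0)] instead of [(-1, 1)],
    that is, the negative of the pair [(1, 0)] of the empty strip: the sum is
    the negative of that for [k] full blocks. *)
Lemma signed_sum_behead_strip k :
  signed_sum cross (behead (strip 0 k.+1)) [::] = (-1) ^+ k.+1 * (1 - k%:Z).
Proof.
rewrite [strip _ _]/= [behead _]/= /signed_sum -/(signed_sum cross) /=.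
by rewrite !signed_sum_strip //= exprS; ring.
Qed.

Lemma strip_mem q k v : v \in strip q k -> (q <= v.1)%N.
Proof.
elim: k q => //= k IH q; rewrite !inE => /or4P[/eqP->|/eqP->|/eqP->|] //.
by case/orP => [/eqP-> //|/IH /ltnW].
Qed.

Lemma strip_uniq q k : uniq (strip q k).
Proof.
elim: k q => // k IH q; rewrite [strip _ _]/= (cat_uniq (block q)) IH andbT.
apply/andP; split; first by rewrite /= !inE !xpair_eqE !eqxx.
apply/hasPn => v /strip_mem; apply: contraL.
by rewrite !inE => /or4P[] /eqP-> /=; rewrite ltnn.
Qed.

Definition strip_graph s : sgraph := induced_sgraph cross_sym cross_irr s.

Lemma strip_graph_planar (R : realType) s : planar R (strip_graph s).
Proof.
pose loc (u : strip_graph s) : vert := val (u : seq_sub s).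
apply: (@book_planar R _ (pos \o loc) (fun u v => page (loc u) (loc v))).
- exact: (inj_comp pos_inj val_inj).
- by move=> u v u' v'; exact: page_crossing.
Qed.

Lemma ends_distinct u v : u != v ->
  [/\ lend u != lend v, lend u != rend v & rend u != rend v].
Proof.
case: u v => [q []] [p []] ne; rewrite /lend /rend /=; split; try lia;
by apply: contra ne => /eqP e; apply/eqP; congr (_, _); lia.
Qed.

Lemma strip_graph_convertible (R : realType) s :
  convertible_in_bcg R (strip_graph s).
Proof.
pose loc (u : strip_graph s) : vert := val (u : seq_sub s).
apply: (@diagram_convertible R _ (lend \o loc) (rend \o loc) (side \o loc)).
- by move=> u; rewrite /= /lend; case: (loc u).2; lia.
- by move=> u; rewrite /= /lend /rend; case: (loc u).2; lia.
- by move=> u v uv; apply: ends_distinct; rewrite (inj_eq val_inj).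
- by [].
- by move=> u v; exact: cross_side.
Qed.

Theorem theorem3 (R : realType) (n : int) :
  exists G : sgraph,
    [/\ planar R G, convertible_in_bcg R G & indep_sum G = n].
Proof.
(* [m.+1] full blocks give [(-1) ^ m * m], and [m.+2] blocks without the first
   [A] give the opposite; take [m] to be the absolute value of [n]. *)
have [s us sn] : exists2 s, uniq s & signed_sum cross s [::] = n.
  have [e|e] : n = (-1) ^+ `|n| * `|n|%N%:Z \/ n = - ((-1) ^+ `|n| * `|n|%N%:Z).
  - rewrite -signr_odd; case: (ler0P n) => [/ler0_norm|/gtr0_norm] h;
    by case: odd; rewrite ?expr0 ?expr1; ((left; lia) || (right; lia)).
  - exists (strip 0 `|n|.+1); first exact: strip_uniq.
    by rewrite signed_sum_strip //= [RHS]e exprS; ring.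
  - exists (behead (strip 0 `|n|.+2)).
      by have := strip_uniq 0 `|n|.+2; rewrite /= => /andP[].
    by rewrite signed_sum_behead_strip [RHS]e !exprS; ring.
exists (strip_graph s); split; last by rewrite indep_sum_induced.
  exact: strip_graph_planar.
exact: strip_graph_convertible.
Qed.
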